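(* The class of unlabelled graphs underlying an element of $\mathcal{L}_1^+$ coincides with the class of graphs of treewidth at most two.
   Context: Graphs are undirected, finite, and without multiple edges; they may have loops. Classes of unlabelled graphs are considered up to isomorphism. A tree decomposition of a graph $F$ is a map $\beta\colon V(T)\to 2^{V(F)}$, where $T$ is a tree, such that $\bigcup_{t\in V(T)}\beta(t)=V(F)$, for every $e\in E(F)$ there is $t\in V(T)$ with $e\subseteq\beta(t)$, and for every $v\in V(F)$ the set of $t\in V(T)$ with $v\in\beta(t)$ induces a connected subgraph of $T$. Its width is $\max_{t\in V(T)}|\beta(t)|-1$. The treewidth of $F$ is the minimal width of a tree decomposition of $F$. A $(1,1)$-bilabelled graph is a tuple $\boldsymbol{F}=(F,u,v)$ with $F$ a graph and $u,v\in V(F)$ (in-label $u$, out-label $v$; $u=v$ is allowed). $F$ is its underlying unlabelled graph. The series composition $\boldsymbol{F}\cdot\boldsymbol{F}'$ of $\boldsymbol{F}=(F,u,v)$ and $\boldsymbol{F}'=(F',u',v')$ is obtained from the disjoint union of $F$ and $F'$ by identifying $v$ with $u'$, with in-label $u$ and out-label $v'$. The parallel composition $\boldsymbol{F}\odot\boldsymbol{F}'$ is obtained from the disjoint union of $F$ and $F'$ by identifying $u$ with $u'$ and $v$ with $v'$, with in-label $u$ and out-label $v$. In both cases, multiple edges arising are removed and loops are kept. The symmetric group $\mathfrak{S}_2$ acts on $(1,1)$-bilabelled graphs by permuting labels, i.e. the non-trivial element sends $(F,u,v)$ to $(F,v,u)$. A $(1,1)$-bilabelled graph is atomic if all its vertices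 are labelled; $\mathcal{A}_1$ is the set of atomic $(1,1)$-bilabelled graphs. $\mathcal{L}_1^+$ is the class of $(1,1)$-bilabelled graphs generated by $\mathcal{A}_1$ under (arbitrary) parallel composition, series composition, and the action of $\mathfrak{S}_2$ on the labels. *)

(* Defs.v *)
From mathcomp Require Import all_boot.
From mathcomp Require Import boolp.

Set Implicit Arguments.
Unset Strict Implicit.
Unset Printing Implicit Defensive.

Local Open Scope nat_scope.
Local Open Scope quotient_scope.

Record graph := Graph {
  vertex :> finType;
  adj : rel vertex;  (* adj x x is a loop at x *)
  adj_sym : symmetric adj }.

Arguments adj {g} : rename.

Definition isomorphic (G H : graph) : Prop :=
  exists2 f : G -> H, bijective f & forall x y : G, adj (f x) (f y) = adj x y.

Section DisjointUnion.
Variables F F' : graph.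

Definition union_adj (x y : F + F') : bool :=
  match x, y with
  | inl a, inl b => adj a b
  | inr a, inr b => adj a b
  | _, _ => false
  end.

Lemma union_adj_sym : symmetric union_adj.
Proof. by case=> [a|a] [b|b] //=; apply: adj_sym. Qed.

Definition disjoint_union : graph := Graph union_adj_sym.

End DisjointUnion.

(* Identification of the two vertices of each pair in s: the quotient by the
   equivalence relation generated by s. *)
Section Identify.
Variables (G : graph) (s : seq (G * G)).

Definition glue_pair : rel G :=
  [rel x y | ((x, y) \in s) || ((y, x) \in s)].

Definition glued : rel G := connect glue_pair.

Lemma glued_refl : reflexive glued.
Proof. exact: connect0. Qed.

Lemma glued_sym : symmetric glued.
Proof. by apply: sym_connect_sym => x y; apply: orbC. Qed.

Lemma glued_trans : transitive glued.
Proof. exact: connect_trans. Qed.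

Canonical glued_equiv := EquivRel glued glued_refl glued_sym glued_trans.

(* quot_type is the alias of the quotient that carries its finType structure. *)
Definition glue_vertex : finType := quot_type {eq_quot glued_equiv}.

Definition glue_proj (x : G) : glue_vertex := \pi_({eq_quot glued_equiv}) x.

Definition glue_adj : rel glue_vertex := fun a b =>
  [exists x : G, exists y : G,
    [&& glue_proj x == a, glue_proj y == b & adj x y]].

Lemma glue_adj_sym : symmetric glue_adj.
Proof.
suff imp a b : glue_adj a b -> glue_adj b a by move=> a b; apply/idP/idP; apply: imp.
case/existsP=> x /existsP[y /and3P[xa yb xy]].
by apply/existsP; exists y; apply/existsP; exists x; rewrite xa yb adj_sym.
Qed.

Definition identify : graph := Graph glue_adj_sym.

End Identify.

(* A (1,1)-bilabelled graph, not a bipartite graph; the labels may coincide. *)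
Record bigraph := Bigraph {
  underlying : graph;
  in_label : underlying;
  out_label : underlying }.

Definition atomic (F : bigraph) : Prop :=
  forall x : underlying F, x = in_label F \/ x = out_label F.

Definition series (F F' : bigraph) : bigraph :=
  let U := disjoint_union (underlying F) (underlying F') in
  let s : seq (U * U) := [:: (inl (out_label F), inr (in_label F'))] in
  @Bigraph (identify s)
    (glue_proj s (inl (in_label F)))
    (glue_proj s (inr (out_label F'))).

Definition parallel (F F' : bigraph) : bigraph :=
  let U := disjoint_union (underlying F) (underlying F') in
  let s : seq (U * U) := [:: (inl (in_label F), inr (in_label F'));
                             (inl (out_label F), inr (out_label F'))] in
  @Bigraph (identify s)
    (glue_proj s (inl (in_label F)))
    (glue_proj s (inl (out_label F))).

Definition swap_labels (F : bigraph) : bigraph :=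
  Bigraph (out_label F) (in_label F).

Inductive L1plus : bigraph -> Prop :=
| L1plus_atomic F : atomic F -> L1plus F
| L1plus_parallel F F' : L1plus F -> L1plus F' -> L1plus (parallel F F')
| L1plus_series F F' : L1plus F -> L1plus F' -> L1plus (series F F')
| L1plus_swap F : L1plus F -> L1plus (swap_labels F).

Definition underlies_L1plus (G : graph) : Prop :=
  exists2 F : bigraph, L1plus F & isomorphic (underlying F) G.

Definition induces_connected (G : graph) (A : {set G}) : Prop :=
  {in A &, forall x y : G,
    connect [rel a b : G | [&& a \in A, b \in A & adj a b]] x y}.

(* The last clause excludes cycles of length at least 3; ucycle also accepts
   a loop and an edge traversed back and forth as cycles of length 1 and 2. *)
Definition is_tree (T : graph) : Prop :=
  [/\ 0 < #|T|,
      irreflexive (@adj T),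
      induces_connected [set: T] &
      forall p : seq T, ucycle adj p -> size p <= 2].

Definition tree_decomposition (F T : graph) (beta : T -> {set F}) : Prop :=
  [/\ is_tree T,
      \bigcup_(t : T) beta t = [set: F],
      forall x y : F, adj x y -> exists t : T, [set x; y] \subset beta t &
      forall v : F, induces_connected [set t : T | v \in beta t]].

(* Truncated: the width is 0, not -1, if all bags are empty. *)
Definition width (F T : graph) (beta : T -> {set F}) : nat :=
  (\max_(t : T) #|beta t|) - 1.

Definition has_width (F : graph) (k : nat) : Prop :=
  exists (T : graph) (beta : T -> {set F}),
    tree_decomposition beta /\ width beta = k.

Lemma no_edge_sym : symmetric (fun _ _ : unit => false).
Proof. by []. Qed.

Definition point : graph := Graph no_edge_sym.

Lemma has_some_width (F : graph) : exists k : nat, `[< has_width F k >].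
Proof.
pose beta (_ : point) := [set: F].
exists (width beta); apply/asboolP; exists point, beta; split=> //; split.
- split=> //; first by rewrite card_unit.
  + by move=> [] [] _ _; apply: connect0.
  + by case=> [|[] [|[] p]] //= /andP[].
- by apply/setP=> x; rewrite inE; apply/bigcupP; exists tt.
- by move=> x y _; exists tt; rewrite subsetT.
- by move=> v [] [] _ _; apply: connect0.
Qed.

Definition treewidth (F : graph) : nat := ex_minn (has_some_width F).

(* Main.v *)
(** Labels of a graph in $\mathcal{L}_1^+$ always share a bag of some
    decomposition into bags of size at most three. For a composition, join the
    two decomposition trees through a new node whose bag consists of the four
    labels; it contains every pair to be identified, so that the image under
    the gluing is again a decomposition, and the new bag is left with at most
    three vertices.

    Conversely, adding the nodes of a decomposition tree one at a time along
    tree edges embeds a graph with at least two vertices and treewidth at most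
    two in a 2-tree. Let each edge of this 2-tree carry an element of
    $\mathcal{L}_1^+$ between its ends, at first the subgraph of G induced by
    the edge. The last vertex x added, on an edge ab, is eliminated by composing
    ax and xb in series and the result in parallel with ab, until only one edge
    remains, which carries all of G. *)

Require Import Defs.
From mathcomp Require Import all_boot boolp.

Set Implicit Arguments.
Unset Strict Implicit.
Unset Printing Implicit Defensive.

Local Open Scope nat_scope.
Local Open Scope quotient_scope.

Lemma homo_connect (T T' : finType) (e : rel T) (e' : rel T') (h : T -> T') x y :
  {homo h : a b / e a b >-> e' a b} -> connect e x y -> connect e' (h x) (h y).
Proof.
move=> he /connectP[p ep ->]; apply/connectP.
by exists (map h p); [exact: homo_path ep | rewrite last_map].
Qed.

(** * Joining two trees by an edge *)

Section Bridge.
Variables (T1 T2 : graph) (t1 : T1) (t2 : T2).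

Definition bridge_adj (x y : T1 + T2) : bool :=
  match x, y with
  | inl a, inl b => adj a b
  | inr a, inr b => adj a b
  | inl a, inr b | inr b, inl a => (a == t1) && (b == t2)
  end.

Lemma bridge_adj_sym : symmetric bridge_adj.
Proof. by case=> [a|a] [b|b] //=; apply: adj_sym. Qed.

Definition bridge : graph := Graph bridge_adj_sym.

Lemma bridge_enter a p x :
    path bridge_adj (inl a) p -> inr x \in p ->
  exists p1 p2, p = p1 ++ inr t2 :: p2 /\ last (inl a) p1 = inl t1.
Proof.
elim: p a => [|[b|b] p IHp] a //=; last first.
  by move=> /andP[/andP[/eqP-> /eqP->] _] _; exists [::], p.
move=> /andP[_ bp]; rewrite inE /= => xp.
have [p1 [p2 [-> <-]]] := IHp b bp xp.
by exists (inl b :: p1), p2.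
Qed.

Lemma bridge_exit x p a :
    path bridge_adj (inr x) p -> last (inr x) p = inl a ->
  inr t2 \in inr x :: p.
Proof.
elim: p x => [|[b|b] p IHp] x //=.
  by move=> /andP[/andP[_ /eqP->] _] _; rewrite mem_head.
by move=> /andP[_ bp] /(IHp _ bp) t2p; rewrite inE t2p orbT.
Qed.

(** A path from [t2] into the first tree must leave the second one at [t2]. Being simple, it does
    not return there, so its first step already crosses the bridge, and having reached its end [t1]
    it stops. *)
Lemma bridge_cross p :
    path bridge_adj (inr t2) p -> uniq (inr t2 :: p) ->
  last (inr t2) p = inl t1 -> p = [:: inl t1].
Proof.
case: p => [|[b|b] p] //=.
  move=> /andP[/andP[/eqP-> _] _] /and3P[_ bp _].
  by case: p bp => // y p /negP t1p /= lp; case: t1p; rewrite -lp mem_last.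
by move=> /andP[_ bp] /andP[/negP t2p _] /(bridge_exit bp).
Qed.

Lemma bridge_tree : is_tree T1 -> is_tree T2 -> is_tree bridge.
Proof.
move=> [T1_gt0 irr1 conn1 acyc1] [T2_gt0 irr2 conn2 acyc2]; split.
- by rewrite card_sum addn_gt0 T1_gt0.
- by case=> x /=; [apply: irr1 | apply: irr2].
- have sub1 a b : connect (@adj bridge) (inl a) (inl b).
    apply: homo_connect (conn1 a b (in_setT _) (in_setT _)) => c d /=.
    by rewrite !inE.
  have sub2 a b : connect (@adj bridge) (inr a) (inr b).
    apply: homo_connect (conn2 a b (in_setT _) (in_setT _)) => c d /=.
    by rewrite !inE.
  have sym : connect_sym (@adj bridge).
    by apply: sym_connect_sym; apply: adj_sym.
  have sub12 a b : connect (@adj bridge) (inl a) (inr b).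
    apply: connect_trans (sub1 a t1) _; apply: connect_trans (sub2 t2 b).
    by apply: connect1; rewrite /= !eqxx.
  move=> x y _ _; rewrite (@eq_connect _ _ (@adj bridge)); last first.
    by move=> u v /=; rewrite !inE.
  by case: x y => a [] b //; rewrite sym.
- move=> p pcyc.
  (* A cycle inside one of the trees is bounded by the acyclicity of that tree. What remains is a
     cycle with vertices on both sides. *)
  have [/hasP[[] // x xp _]|no_inr] :=
    boolP (has (fun z : T1 + T2 => if z is inr _ then true else false) p); last first.
    have [q def_p] : exists q : seq T1, p = map inl q.
      elim: p no_inr {pcyc} => [|[a|a] p IHp] //=; first by exists [::].
      by move=> /IHp[q ->]; exists (a :: q).
    rewrite def_p size_map; apply: acyc1; move: pcyc.
    rewrite def_p /ucycle map_inj_uniq; last by move=> ? ? [].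
    by rewrite cycle_map.
  have [/hasP[[] // a ap _]|no_inl] :=
    boolP (has (fun z : T1 + T2 => if z is inl _ then true else false) p); last first.
    have [q def_p] : exists q : seq T2, p = map inr q.
      elim: p no_inl {pcyc xp} => [|[b|b] p IHp] //=; first by exists [::].
      by move=> /IHp[q ->]; exists (b :: q).
    rewrite def_p size_map; apply: acyc2; move: pcyc.
    rewrite def_p /ucycle map_inj_uniq; last by move=> ? ? [].
    by rewrite cycle_map.
  have [i p' def_p] := rot_to ap.
  move: pcyc; rewrite -(rot_ucycle i) -(size_rot i) def_p.
  move: xp; rewrite -(mem_rot i) def_p inE => /= xp' p'cyc.
  have ap' : path bridge_adj (inl a) p'.
    by move: p'cyc => /andP[/=]; rewrite rcons_path => /andP[].
  (* The mixed cycle passes from [t1] to [t2] somewhere. Rotated to start at [t2], it is a simple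
     path from [t2] ending in [t1], hence the bridge traversed back and forth, of size 2. *)
  have [p1 [p2 [def_p' last_p1]]] := bridge_enter ap' xp'.
  have rot_p' : rot (size p1).+1 (inl a :: p') = inr t2 :: p2 ++ inl a :: p1.
    by rewrite def_p' -cat_cons; exact: (rot_size_cat (inl a :: p1)).
  change (size (inl a :: p') <= 2); rewrite -(size_rot (size p1).+1) rot_p'.
  move: p'cyc; rewrite -(rot_ucycle (size p1).+1) rot_p'.
  move=> /andP[cyc uni].
  suff -> : p2 ++ inl a :: p1 = [:: inl t1] by [].
  apply: bridge_cross => //; last by rewrite last_cat.
  by move: cyc; rewrite /= rcons_path => /andP[].
Qed.

End Bridge.

Lemma point_tree : is_tree point.
Proof.
split=> //; first by rewrite card_unit.
- by move=> [] [] _ _; apply: connect0.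
- by case=> [|[] [|[] p]] //= /andP[].
Qed.

(** * Images and unions of tree decompositions *)

(* Applied with [r] generating the fibers of [f]: related vertices share a bag,
   so that the node sets of the vertices of a fiber join up. *)
Lemma imset_decomposition (F G T : graph) (beta : T -> {set F}) (f : F -> G)
    (r : rel F) :
    (forall y, exists x, f x = y) ->
    (forall y z : G, adj y z -> exists a b, [/\ f a = y, f b = z & adj a b]) ->
    (forall x y, f x = f y -> connect r x y) ->
    (forall x y, r x y -> f x = f y /\ exists t, x \in beta t /\ y \in beta t) ->
  tree_decomposition beta -> tree_decomposition (fun t => f @: beta t).
Proof.
move=> f_surj f_adj f_fiber r_bag [treeT cover edge conn].
have in_bag x : exists t, x \in beta t.
  have: x \in \bigcup_t beta t by rewrite cover inE.
  by case/bigcupP=> t _ xt; exists t.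
split=> //.
- apply/setP=> y; rewrite inE; have [x <-] := f_surj y; have [t xt] := in_bag x.
  by apply/bigcupP; exists t => //; apply: imset_f.
- move=> y z /f_adj[a [b [<- <- /edge[t]]]]; rewrite subUset !sub1set => /andP[at_ bt].
  by exists t; rewrite subUset !sub1set !imset_f.
move=> v t t'; rewrite !inE => /imsetP[x xt ->] /imsetP[y yt' fxy].
have /connectP[p] := f_fiber _ _ fxy.
have conn_in a s s' : a \in beta s -> a \in beta s' ->
  connect [rel c d | [&& c \in [set t | f a \in f @: beta t],
                        d \in [set t | f a \in f @: beta t] & adj c d]] s s'.
  move=> sa s'a; apply: homo_connect (conn a s s' _ _); rewrite ?inE //.
  by move=> c d /=; rewrite !inE => /and3P[ac ad ->]; rewrite !imset_f.
elim: p x t xt {fxy} => [|z p IHp] x t xt /=.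
  by move=> _ def_y; apply: conn_in xt _; rewrite -def_y.
move=> /andP[/r_bag[fxz [s [xs zs]]] zp] def_y.
apply: connect_trans (conn_in _ _ _ xt xs) _.
by rewrite fxz; apply: IHp.
Qed.

Section UnionDecomposition.
Variables (F1 F2 T1 T2 : graph) (beta1 : T1 -> {set F1}) (beta2 : T2 -> {set F2}).
Variables (t1 : T1) (t2 : T2) (u1 v1 : F1) (u2 v2 : F2).

(** Two bridges in a row: the new node [inl (inr tt)] is adjacent to exactly [t1] and [t2]. *)
Let T := bridge (inr tt : bridge t1 (tt : point)) t2.

Definition union_bag (t : T) : {set disjoint_union F1 F2} :=
  match t with
  | inl (inl s) => inl @: beta1 s
  | inl (inr _) => [set inl u1; inl v1; inr u2; inr v2]
  | inr s => inr @: beta2 s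
  end.

(** A vertex in the middle bag is a label, so it also lies in the bag at [t1] or [t2] on its own
    side. The middle node thus extends the connected node set of that vertex by a neighbour. *)
Lemma union_decomposition :
    tree_decomposition beta1 -> tree_decomposition beta2 ->
    u1 \in beta1 t1 -> v1 \in beta1 t1 -> u2 \in beta2 t2 -> v2 \in beta2 t2 ->
  tree_decomposition union_bag.
Proof.
move=> [tree1 cover1 edge1 conn1] [tree2 cover2 edge2 conn2] u1t v1t u2t v2t.
split.
- by apply: bridge_tree => //; apply: bridge_tree => //; exact: point_tree.
- apply/setP=> -[x|x]; rewrite inE; apply/bigcupP.
    have: x \in \bigcup_t beta1 t by rewrite cover1 inE.
    by case/bigcupP=> t _ xt; exists (inl (inl t)); rewrite //= imset_f.
  have: x \in \bigcup_t beta2 t by rewrite cover2 inE.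
  by case/bigcupP=> t _ xt; exists (inr t); rewrite //= imset_f.
- move=> [x|x] [y|y] //= xy.
    have [t] := edge1 _ _ xy; rewrite subUset !sub1set => /andP[xt yt].
    by exists (inl (inl t)); rewrite subUset !sub1set !imset_f.
  have [t] := edge2 _ _ xy; rewrite subUset !sub1set => /andP[xt yt].
  by exists (inr t); rewrite subUset !sub1set !imset_f.
have inj1 : injective (inl : F1 -> F1 + F2) by move=> ? ? [].
have inj2 : injective (inr : F2 -> F1 + F2) by move=> ? ? [].
move=> v; pose A := [set t | v \in union_bag t].
pose e : rel T := [rel a b | [&& a \in A, b \in A & adj a b]]; have e_sym : connect_sym e.
  by apply: sym_connect_sym => a b; apply/and3P/and3P=> -[? ? ?];
    split=> //; rewrite (@adj_sym T).
(* It is enough to link every node of [A] to one root: the middle node if it belongs to [A], and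
   otherwise any node of the tree on the side of the vertex. *)
suff [r r_conn] : exists r, forall t, t \in A -> connect e t r.
  by move=> t t' /r_conn tr /r_conn; rewrite e_sym; apply: connect_trans.
case: v @A @e e_sym => x A e e_sym.
- have out (t : T2) : inr t \notin A by rewrite inE /=; apply/negP=> /imsetP[].
  have inA (s : T1) : (inl (inl s) \in A) = (x \in beta1 s) by rewrite inE mem_imset.
  have conn a b : x \in beta1 a -> x \in beta1 b -> connect e (inl (inl a)) (inl (inl b)).
    move=> xa xb.
    apply: (homo_connect (h := fun s => inl (inl s))) (conn1 x a b _ _); rewrite ?inE //.
    by move=> c d /=; rewrite /e /= !inA !inE.
  have [mid|no_mid] := boolP (inl (inr tt) \in A).
    have xt1 : x \in beta1 t1.
      by move: mid; rewrite !inE /= => /orP[/orP[/orP[/eqP[->]|/eqP[->]]|/eqP]|/eqP].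
    exists (inl (inr tt)) => -[[t|[]]|t]; last by move/negP: (out t).
      rewrite inA => xt; apply: connect_trans (conn _ _ xt xt1) _; apply: connect1.
      by rewrite /e /= inA xt1 mid eqxx.
    by [].
  have: x \in \bigcup_t beta1 t by rewrite cover1 inE.
  case/bigcupP=> r _ xr; exists (inl (inl r)) => -[[t|[]]|t].
  + by rewrite inA => xt; apply: conn.
  + by move/negP: no_mid.
  + by move/negP: (out t).
- have out (t : T1) : inl (inl t) \notin A by rewrite inE /=; apply/negP=> /imsetP[].
  have inA (s : T2) : (inr s \in A) = (x \in beta2 s) by rewrite inE mem_imset.
  have conn a b : x \in beta2 a -> x \in beta2 b -> connect e (inr a) (inr b).
    move=> xa xb; apply: (homo_connect (h := inr)) (conn2 x a b _ _); rewrite ?inE //.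
    by move=> c d /=; rewrite /e /= !inA !inE.
  have [mid|no_mid] := boolP (inl (inr tt) \in A).
    have xt2 : x \in beta2 t2.
      by move: mid; rewrite !inE /= => /orP[/eqP[->]|/eqP[->]].
    exists (inl (inr tt)) => -[[t|[]]|t]; first by move/negP: (out t).
      by [].
    rewrite inA => xt; apply: connect_trans (conn _ _ xt xt2) _; apply: connect1.
    by rewrite /e /= inA xt2 mid !eqxx.
  have: x \in \bigcup_t beta2 t by rewrite cover2 inE.
  case/bigcupP=> r _ xr; exists (inr r) => -[[t|[]]|t].
  + by move/negP: (out t).
  + by move/negP: no_mid.
  + by rewrite inA => xt; apply: conn.
Qed.

End UnionDecomposition.

(** * Small decompositions of the graphs in [L1plus] *)

Lemma glue_projP (G : graph) (s : seq (G * G)) (x y : G) :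
  reflect (glue_proj s x = glue_proj s y) (glued s x y).
Proof. exact: eqmodP. Qed.

Lemma glue_proj_surj (G : graph) (s : seq (G * G)) (a : glue_vertex s) :
  exists x, glue_proj s x = a.
Proof. by exists (repr a); apply: reprK. Qed.

Lemma glue_proj_pair (G : graph) (s : seq (G * G)) (x y : G) :
  (x, y) \in s -> glue_proj s x = glue_proj s y.
Proof. by move=> xy; apply/glue_projP/connect1/orP; left. Qed.

Lemma glue_adjP (G : graph) (s : seq (G * G)) (a b : identify s) :
  reflect (exists x y, [/\ glue_proj s x = a, glue_proj s y = b & adj x y])
          (adj a b).
Proof.
apply: (iffP existsP) => [[x /existsP[y /and3P[/eqP<- /eqP<- xy]]]|[x [y [<- <- xy]]]].
  by exists x, y.
by exists x; apply/existsP; exists y; rewrite !eqxx.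
Qed.

Lemma glue_decomposition (G T : graph) (beta : T -> {set G}) (s : seq (G * G)) :
    (forall x y, (x, y) \in s -> exists t, x \in beta t /\ y \in beta t) ->
  tree_decomposition beta ->
  tree_decomposition (fun t => glue_proj s @: beta t : {set identify s}).
Proof.
move=> s_bag; apply: (@imset_decomposition _ (identify s) _ _ _ (glue_pair s)).
- exact: glue_proj_surj.
- by move=> y z /glue_adjP.
- by move=> x y /glue_projP.
- move=> x y xy; split; first by apply/glue_projP/connect1.
  by case/orP: xy => /s_bag[t []]; exists t.
Qed.

Definition small_decomposition (F : bigraph) : Prop :=
  exists (T : graph) (beta : T -> {set underlying F}) (t : T),
    [/\ tree_decomposition beta, forall s, #|beta s| <= 3,
        in_label F \in beta t & out_label F \in beta t].

(** Common to both compositions: each identifies labels only and takes its new labels among the old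
    ones, so everything new happens in the middle bag [B]. Only the bound on the image of [B]
    depends on the kind of composition. *)
Lemma small_decomposition_glue (F1 F2 : bigraph)
    (s : seq (disjoint_union (underlying F1) (underlying F2)
              * disjoint_union (underlying F1) (underlying F2)))
    (B := [set inl (in_label F1); inl (out_label F1);
               inr (in_label F2); inr (out_label F2)])
    (u v : identify s) :
    small_decomposition F1 -> small_decomposition F2 ->
    (forall x y, (x, y) \in s -> x \in B /\ y \in B) ->
    #|glue_proj s @: B| <= 3 ->
    u \in glue_proj s @: B -> v \in glue_proj s @: B ->
  small_decomposition (Bigraph u v).
Proof.
move=> [T1 [beta1 [t1 [dec1 small1 u1 v1]]]] [T2 [beta2 [t2 [dec2 small2 u2 v2]]]].
move=> sB B3 uB vB.
have dec := union_decomposition dec1 dec2 u1 v1 u2 v2.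
pose T := bridge (inr tt : bridge t1 (tt : point)) t2.
pose mid : T := inl (inr tt).
pose bag : T -> _ := union_bag beta1 beta2 (in_label F1) (out_label F1)
                       (in_label F2) (out_label F2).
exists T, (fun t => glue_proj s @: bag t), mid.
split; first apply: glue_decomposition dec.
- by move=> x y /sB[xB yB]; exists mid.
- move=> [[t|[]]|t] //=; apply: leq_trans (leq_imset_card _ _) _.
    by apply: leq_trans (leq_imset_card _ _) _.
  by apply: leq_trans (leq_imset_card _ _) _.
- exact: uB.
- exact: vB.
Qed.

Lemma L1plus_small_decomposition (F : bigraph) : L1plus F -> small_decomposition F.
Proof.
elim=> {F} [F atomF | F1 F2 _ dec1 _ dec2 | F1 F2 _ dec1 _ dec2
            | F _ [T [beta [t [dec small u v]]]]].
- exists point, (fun=> setT), tt; split; rewrite ?inE //.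
    split=> //; first exact: point_tree.
    + by apply/setP=> x; rewrite inE; apply/bigcupP; exists tt; rewrite ?inE.
    + by move=> v [] [] _ _; apply: connect0.
  move=> _; apply: (@leq_trans #|[set in_label F; out_label F]|); last first.
    by rewrite cards2; case: (_ != _).
  apply/subset_leq_card/subsetP=> x _; rewrite !inE.
  by case: (atomF x) => ->; rewrite eqxx ?orbT.
- pose U := disjoint_union (underlying F1) (underlying F2).
  rewrite /parallel; set s : seq (U * U) := [:: _; _].
  have e1 := @glue_proj_pair U s _ _ (mem_head _ _).
  have e2 : glue_proj s (inl (out_label F1)) = glue_proj s (inr (out_label F2)).
    by apply: glue_proj_pair; rewrite !inE eqxx orbT.
  apply: small_decomposition_glue => //.
  + move=> x y; rewrite !inE => /orP[] /eqP[-> ->]; by rewrite !eqxx ?orbT.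
  (* Parallel composition merges the four labels into at most two vertices. *)
  + apply: (@leq_trans #|[set glue_proj s (inr (in_label F2));
                              glue_proj s (inr (out_label F2))]|).
      apply/subset_leq_card/subsetP=> _ /imsetP[x + ->]; rewrite !inE.
      by case/orP=> [/orP[/orP[]|]|] /eqP->; rewrite ?e1 ?e2 eqxx ?orbT.
    by rewrite cards2; case: (_ != _).
  + by rewrite imset_f // !inE eqxx ?orbT.
  + by rewrite imset_f // !inE eqxx ?orbT.
- pose U := disjoint_union (underlying F1) (underlying F2).
  rewrite /series; set s : seq (U * U) := [:: _].
  have e1 := @glue_proj_pair U s _ _ (mem_head _ _).
  apply: small_decomposition_glue => //.
  + move=> x y; rewrite !inE => /eqP[-> ->]; by rewrite !eqxx ?orbT.
  (* Series composition merges one pair of labels, so up to three vertices remain; here the bag size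
     three is needed. *)
  + apply: (@leq_trans #|[set glue_proj s (inl (in_label F1));
                              glue_proj s (inr (in_label F2));
                              glue_proj s (inr (out_label F2))]|).
      apply/subset_leq_card/subsetP=> _ /imsetP[x + ->]; rewrite !inE.
      by case/orP=> [/orP[/orP[]|]|] /eqP->; rewrite ?e1 eqxx ?orbT.
    apply: leq_trans (leq_card_setU _ _) _; rewrite cards2 cards1.
    by case: (_ != _).
  + by rewrite imset_f // !inE eqxx ?orbT.
  + by rewrite imset_f // !inE eqxx ?orbT.
- by exists T, beta, t.
Qed.

(** * From [L1plus] to treewidth at most two *)

(** The truncated subtraction in [width] is harmless for upper bounds: the 1 moves to the other side
    of the inequality, also when all bags are empty. *)
Lemma treewidth_le (G : graph) (k : nat) :
  treewidth G <= k <->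
  exists (T : graph) (beta : T -> {set G}),
    tree_decomposition beta /\ forall t, #|beta t| <= k.+1.
Proof.
have widthE (T : graph) (beta : T -> {set G}) :
  width beta <= k <-> forall t, #|beta t| <= k.+1.
  rewrite /width leq_subLR add1n; split=> [le_k t|le_k].
    by apply: leq_trans le_k; apply: (@leq_bigmax T (fun t => #|beta t|)).
  by apply/bigmax_leqP.
rewrite /treewidth; case: ex_minnP => m /asboolP[T [beta [dec def_m]]] min_m.
split=> [m_k|[T' [beta' [dec' /widthE]]]].
  by exists T, beta; split=> //; apply/widthE; rewrite def_m.
by apply: leq_trans; apply: min_m; apply/asboolP; exists T', beta'.
Qed.

Lemma underlies_treewidth (G : graph) : underlies_L1plus G -> treewidth G <= 2.
Proof.
case=> F /L1plus_small_decomposition[T [beta [t [dec small _ _]]]] [f f_bij f_adj].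
have [g fK gK] := f_bij.
apply/treewidth_le; exists T, (fun t => f @: beta t); split=> [|s]; last first.
  exact: leq_trans (leq_imset_card _ _) (small s).
(* An isomorphism has singleton fibers, which the empty relation generates. *)
apply: (@imset_decomposition _ _ _ _ _ (fun _ _ => false)) => //.
- by move=> y; exists (g y).
- by move=> y z yz; exists (g y), (g z); rewrite -f_adj !gK.
- by move=> x y /(bij_inj f_bij)->; apply: connect0.
Qed.

(** * Compositions inside a fixed vertex set *)

Section Internal.
Variable V : finType.
Implicit Types (A : V -> Prop) (E : V -> V -> Prop).

(* The subgraph of V with vertex set A and edge set E, labelled by u and v, is
   isomorphic to an element of $\mathcal{L}_1^+$. *)
Definition internal A E (u v : V) : Prop :=
  exists (F : bigraph) (f : underlying F -> V),
    [/\ L1plus F /\ injective f, f (in_label F) = u, f (out_label F) = v,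
        forall x, A x <-> exists a, f a = x &
        forall x y, E x y <-> exists a b, [/\ f a = x, f b = y & adj a b]].

Lemma internal_ext A A' E E' u v :
    (forall x, A x <-> A' x) -> (forall x y, E x y <-> E' x y) ->
  internal A E u v -> internal A' E' u v.
Proof.
move=> AA' EE' [F [f [Lf fu fv fA fE]]]; exists F, f; split=> // [x|x y].
  by rewrite -AA'.
by rewrite -EE'.
Qed.

Lemma internal_swap A E u v : internal A E u v -> internal A E v u.
Proof.
move=> [F [f [[LF f_inj] fu fv fA fE]]].
by exists (swap_labels F), f; split=> //; split=> //; apply: L1plus_swap.
Qed.

Lemma internal_atomic A E u v :
    (forall x, A x <-> x \in [set u; v]) -> (forall x y, E x y -> E y x) ->
    (forall x y, E x y -> A x) ->
  internal A E u v.
Proof.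
move=> A_uv E_sym E_A.
pose W : finType := {x : V | x \in [set u; v]}.
have sym : symmetric (fun x y : W => `[< E (val x) (val y) >]).
  by move=> x y; apply/asboolP/asboolP; apply: E_sym.
have uW : u \in [set u; v] by rewrite !inE eqxx.
have vW : v \in [set u; v] by rewrite !inE eqxx orbT.
exists (@Bigraph (Graph sym) (Sub u uW) (Sub v vW)), val; split=> //.
- split; last exact: val_inj.
  apply: L1plus_atomic => x /=.
  have := valP x; rewrite !inE => /orP[] /eqP def_x; [left|right]; exact: val_inj.
- move=> x; rewrite A_uv; split=> [xW|[a <-]]; last exact: valP.
  by exists (Sub x xW).
- move=> x y; split=> [xy|[a [b [<- <- /asboolP]]]] //.
  have xW := E_A _ _ xy; have yW := E_A _ _ (E_sym _ _ xy).
  move: xW yW; rewrite !A_uv => xW yW.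
  by exists (Sub x xW), (Sub y yW); split=> //; apply/asboolP.
Qed.

(** The map [f] on the disjoint union is constant on glued classes, so it factors through the
    quotient. The factor is injective because [f1] and [f2] are, and because every coincidence
    between their images is listed in [s]. *)
Lemma glue_embedding (F1 F2 : graph) (f1 : F1 -> V) (f2 : F2 -> V)
    (f := fun x => match x with inl a => f1 a | inr b => f2 b end)
    (s : seq (disjoint_union F1 F2 * disjoint_union F1 F2)) :
    injective f1 -> injective f2 ->
    (forall x y, (x, y) \in s -> f x = f y) ->
    (forall a b, f1 a = f2 b -> (inl a, inr b) \in s) ->
  exists h : identify s -> V,
    [/\ injective h, forall x, h (glue_proj s x) = f x,
        forall x, (exists q, h q = x) <->
                  (exists a, f1 a = x) \/ (exists b, f2 b = x) &
        forall x y, (exists p q, [/\ h p = x, h q = y & adj p q]) <->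
          (exists a b, [/\ f1 a = x, f1 b = y & adj a b]) \/
          (exists a b, [/\ f2 a = x, f2 b = y & adj a b])].
Proof.
move=> inj1 inj2 s_f f_s.
have glued_f x y : glued s x y -> f x = f y.
  case/connectP=> p; elim: p x => [|z p IHp] x /= => [_ -> //|/andP[xz zp] def_y].
  by rewrite -(IHp z zp def_y); case/orP: xz => /s_f.
have f_glued x y : f x = f y -> glued s x y.
  case: x y => [a|a] [b|b] /= => [/inj1->|/f_s ab|/esym/f_s ab|/inj2->].
  - exact: glued_refl.
  - by apply: connect1; apply/orP; left.
  - by apply: connect1; apply/orP; right.
  - exact: glued_refl.
pose h (q : identify s) := f (repr (q : {eq_quot glued_equiv s})).
have h_proj x : h (glue_proj s x) = f x.
  by apply: glued_f; apply/glue_projP; exact: reprK.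
exists h; split=> //.
- move=> p q; have [x <-] := glue_proj_surj p; have [y <-] := glue_proj_surj q.
  by rewrite !h_proj => /f_glued/glue_projP.
- move=> x; split=> [[q <-]|[[a <-]|[b <-]]].
  + have [[a|b] <-] := glue_proj_surj q; rewrite h_proj; first by left; exists a.
    by right; exists b.
  + by exists (glue_proj s (inl a)); rewrite h_proj.
  + by exists (glue_proj s (inr b)); rewrite h_proj.
- move=> x y; split=> [[p [q [<- <- /glue_adjP[a [b [<- <-]]]]]]|].
    by rewrite !h_proj; case: a b => [a|a] [b|b] //= ab; [left|right]; exists a, b.
  case=> -[a [b [<- <- ab]]].
    exists (glue_proj s (inl a)), (glue_proj s (inl b)); rewrite !h_proj; split=> //.
    by apply/glue_adjP; exists (inl a), (inl b).
  exists (glue_proj s (inr a)), (glue_proj s (inr b)); rewrite !h_proj; split=> //.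
  by apply/glue_adjP; exists (inr a), (inr b).
Qed.

(** Since the two pieces meet only in the labels, the pairs glued by the composition are all the
    coincidences of the two embeddings, as [glue_embedding] demands. The series case below has the
    same reason, with [w] as the only common vertex. *)
Lemma internal_parallel A1 A2 E1 E2 u v :
    (forall x, A1 x -> A2 x -> x \in [set u; v]) ->
    internal A1 E1 u v -> internal A2 E2 u v ->
  internal (fun x => A1 x \/ A2 x) (fun x y => E1 x y \/ E2 x y) u v.
Proof.
move=> A12 [F1 [f1 [[L1 inj1] u1 v1 A1P E1P]]] [F2 [f2 [[L2 inj2] u2 v2 A2P E2P]]].
pose U := disjoint_union (underlying F1) (underlying F2).
pose s : seq (U * U) := [:: (inl (in_label F1), inr (in_label F2));
                            (inl (out_label F1), inr (out_label F2))].
have [|a b ab|h [h_inj h_proj hA hE]] := @glue_embedding _ _ _ _ s inj1 inj2.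
- by move=> x y; rewrite !inE => /orP[] /eqP[-> ->]; rewrite ?u1 ?u2 ?v1 ?v2.
- have: f1 a \in [set u; v].
    by apply: A12; [apply/A1P; exists a | apply/A2P; exists b; rewrite ab].
  rewrite !inE => /orP[] /eqP fa; apply/orP; [left|right]; apply/eqP.
    by congr (inl _, inr _); [apply: inj1 | apply: inj2; rewrite -ab]; rewrite fa.
  by congr (inl _, inr _); [apply: inj1 | apply: inj2; rewrite -ab]; rewrite fa.
exists (parallel F1 F2), h; split.
- by split=> //; apply: L1plus_parallel.
- by rewrite h_proj.
- by rewrite h_proj.
- by move=> x; rewrite A1P A2P hA.
- by move=> x y; rewrite E1P E2P hE.
Qed.

Lemma internal_series A1 A2 E1 E2 u v w :
    (forall x, A1 x -> A2 x -> x = w) ->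
    internal A1 E1 u w -> internal A2 E2 w v ->
  internal (fun x => A1 x \/ A2 x) (fun x y => E1 x y \/ E2 x y) u v.
Proof.
move=> A12 [F1 [f1 [[L1 inj1] u1 v1 A1P E1P]]] [F2 [f2 [[L2 inj2] u2 v2 A2P E2P]]].
pose U := disjoint_union (underlying F1) (underlying F2).
pose s : seq (U * U) := [:: (inl (out_label F1), inr (in_label F2))].
have [|a b ab|h [h_inj h_proj hA hE]] := @glue_embedding _ _ _ _ s inj1 inj2.
- by move=> x y; rewrite !inE => /eqP[-> ->]; rewrite v1 u2.
- have fa : f1 a = w.
    by apply: A12; [apply/A1P; exists a | apply/A2P; exists b; rewrite ab].
  apply/orP; left; apply/eqP.
  by congr (inl _, inr _); [apply: inj1 | apply: inj2; rewrite -ab]; rewrite fa.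
exists (series F1 F2), h; split.
- by split=> //; apply: L1plus_series.
- by rewrite h_proj.
- by rewrite h_proj.
- by move=> x; rewrite A1P A2P hA.
- by move=> x y; rewrite E1P E2P hE.
Qed.

(** * Growing 2-trees *)

(* A vertex set S and the edge set H of a 2-tree on it, edges being unordered
   pairs; graphs with at most one vertex are admitted as well. *)
Inductive twotree : {set V} -> {set {set V}} -> Prop :=
| twotree_empty : twotree set0 set0
| twotree_vertex x : twotree [set x] set0
| twotree_edge a b : a != b -> twotree [set a; b] [set [set a; b]]
| twotree_step S H a b x :
    twotree S H -> a != b -> [set a; b] \in H -> x \notin S ->
    twotree (x |: S) ([set a; x] |: ([set b; x] |: H)).

Definition clique (K : {set V}) (H : {set {set V}}) : Prop :=
  forall y z, y \in K -> z \in K -> y != z -> [set y; z] \in H.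

Lemma twotree_edges S H e : twotree S H -> e \in H -> e \subset S /\ #|e| = 2.
Proof.
move=> SH; elim: SH e => {S H} [|x|a b ab|S H a b x SH IH ab abH xS] e; rewrite ?inE //.
  by move=> /eqP->; rewrite subxx cards2 ab.
have [abS _] := IH _ abH; move: abS; rewrite subUset !sub1set => /andP[aS bS].
have neq y : y \in S -> y != x by apply: contraTneq => ->.
case/or3P=> [/eqP->|/eqP->|/IH[eS ->]].
- by rewrite subUset !sub1set !inE eqxx aS orbT cards2 neq.
- by rewrite subUset !sub1set !inE eqxx bS orbT cards2 neq.
- by rewrite (subset_trans eS) ?subsetUr.
Qed.

(** This serves to enlarge a clique with at most one vertex to an edge, and later to find an edge
    that carries a given vertex and its loop. *)
Lemma twotree_neighbor S H x :
    twotree S H -> 1 < #|S| -> x \in S ->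
  exists y, x != y /\ [set x; y] \in H.
Proof.
move=> SH; elim: SH x => {S H} [|y|a b ab|S H a b y SH IH ab abH yS] x.
- by rewrite cards0.
- by rewrite cards1.
- move=> _; rewrite !inE => /orP[] /eqP->; first by exists b; rewrite ab set11.
  by exists a; rewrite eq_sym ab setUC set11.
have [abS _] := twotree_edges SH abH.
have aS : a \in S by apply: (subsetP abS); rewrite !inE eqxx.
move=> _; rewrite !inE => /orP[/eqP->|xS].
  by exists a; rewrite setUC !inE eqxx; split=> //; apply: contraNneq yS => ->.
have [|z [xz xzH]] := IH x _ xS; last by exists z; rewrite !inE xzH !orbT.
by rewrite (leq_trans _ (subset_leq_card abS)) // cards2 ab.
Qed.

(** [twotree_step] attaches [x] to both ends of an edge, so [K] is first enlarged to an edge. With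
    at most one vertex in [S] there is no edge yet, and the base constructors take over. *)
Lemma twotree_add S H (K : {set V}) x :
    twotree S H -> K \subset S -> #|K| <= 2 -> clique K H -> x \notin S ->
  exists H', [/\ twotree (x |: S) H', H \subset H' &
                 forall y, y \in K -> [set y; x] \in H'].
Proof.
move=> SH KS K2 Kcl xS.
have [S1|S2] := leqP #|S| 1.
  have H0 : H = set0.
    apply/setP=> e; rewrite inE; apply/negP=> /(twotree_edges SH)[/subset_leq_card].
    by move=> eS e2; move: (leq_trans eS S1); rewrite e2.
  rewrite H0; have [S0|[y yS]] := set_0Vmem S.
    exists set0; rewrite S0 setU0 sub0set; split=> // [|y]; first exact: twotree_vertex.
    by move/(subsetP KS); rewrite S0 inE.
  have defS : S = [set y].
    by apply/esym/eqP; rewrite eqEcard sub1set yS cards1.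
  have yx : y != x by apply: contraNneq xS => <-.
  exists [set [set y; x]]; rewrite sub0set defS setUC; split=> // [|z].
    exact: twotree_edge.
  by move/(subsetP KS); rewrite defS !inE => /eqP->.
have [a [b [ab abH Kab]]] :
  exists a b, [/\ a != b, [set a; b] \in H & K \subset [set a; b]].
  have [K0|[y yK]] := set_0Vmem K.
    have [y yS] : exists y, y \in S by apply/set0Pn; rewrite -card_gt0 ltnW.
    have [z [yz yzH]] := twotree_neighbor SH S2 yS.
    by exists y, z; rewrite K0 sub0set.
  have [K0|[z]] := set_0Vmem (K :\ y).
    have [z [yz yzH]] := twotree_neighbor SH S2 (subsetP KS _ yK).
    exists y, z; split=> //; apply/subsetP=> t tK; apply: contraT; rewrite !inE.
    by case/norP=> ty _; move/setP/(_ t): K0; rewrite !inE ty tK.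
  rewrite !inE => /andP[zy zK]; exists y, z; rewrite eq_sym zy; split=> //.
    by apply: Kcl => //; rewrite eq_sym.
  suff <- : [set y; z] = K by [].
  by apply/eqP; rewrite eqEcard subUset !sub1set yK zK cards2 eq_sym zy.
exists ([set a; x] |: ([set b; x] |: H)); split.
- exact: twotree_step.
- by rewrite setUA subsetUr.
- by move=> y /(subsetP Kab); rewrite !inE => /orP[] /eqP->; rewrite eqxx ?orbT.
Qed.

(** The missing vertices of [b] enter one by one, each joined to the part of [b] already present.
    That part misses the entering vertex, so it has at most two elements, and it stays a clique. *)
Lemma twotree_add_bag S H (b : {set V}) :
    twotree S H -> #|b| <= 3 -> clique (b :&: S) H ->
  exists H', [/\ twotree (b :|: S) H', H \subset H' & clique b H'].
Proof.
move=> SH b3; have [n] := ubnP #|b :\: S|.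
elim: n => // n IHn in S H SH *; rewrite ltnS => bSn bScl.
have [bS|[x]] := set_0Vmem (b :\: S).
  move/eqP: bS; rewrite setD_eq0 => bS; exists H; rewrite (setUidPr bS); split=> //.
  by move: bScl; rewrite (setIidPl bS).
rewrite inE => /andP[xS xb].
have [|H1 [SH1 HH1 xK]] := twotree_add SH (subsetIr b S) _ bScl xS.
  rewrite -ltnS (leq_trans _ b3) //; apply/proper_card/properP.
  split; first exact: subsetIl.
  by exists x; rewrite // inE (negbTE xS) andbF.
have [||H2 [SH2 HH2 bcl]] := IHn _ _ SH1.
- apply: leq_trans bSn; apply/proper_card/properP; split.
    by apply/setDS/subsetUr.
  by exists x; rewrite !inE ?eqxx // xS xb.
- move=> y z; rewrite !inE => /andP[yb yS] /andP[zb zS] yz.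
  case/orP: yS => [/eqP y_x|yS]; case/orP: zS => [/eqP z_x|zS].
  + by rewrite y_x z_x eqxx in yz.
  + by rewrite setUC y_x; apply: xK; rewrite inE zb.
  + by rewrite z_x; apply: xK; rewrite inE yb.
  + by apply/(subsetP HH1)/bScl; rewrite ?inE ?yb ?zb.
exists H2; split=> //; last exact: subset_trans HH2.
by rewrite setUCA (setUidPr _) // in SH2; rewrite sub1set inE xb.
Qed.

(** * Eliminating the vertices of a 2-tree *)

Lemma set2_inj (a b c d : V) :
  a != b -> [set a; b] = [set c; d] -> (a = c /\ b = d) \/ (a = d /\ b = c).
Proof.
move=> ab abcd; have : a \in [set c; d] by rewrite -abcd !inE eqxx.
have : b \in [set c; d] by rewrite -abcd !inE eqxx orbT.
rewrite !inE => /orP[] /eqP def_b /orP[] /eqP def_a; auto.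
  by rewrite def_a def_b eqxx in ab.
by rewrite def_a def_b eqxx in ab.
Qed.

(* [A e] and [E e] are the vertices and edges of the piece carried by [e]. *)
Lemma twotree_internal S H (A : {set V} -> V -> Prop) (E : {set V} -> V -> V -> Prop) :
    twotree S H -> H != set0 ->
    (forall a b, a != b -> [set a; b] \in H ->
       internal (A [set a; b]) (E [set a; b]) a b) ->
    (forall e y, e \in H -> y \in S -> A e y -> y \in e) ->
    (forall e e' y, e \in H -> e' \in H -> e != e' -> A e y -> A e' y -> y \in e) ->
  exists u v, internal (fun y => exists2 e, e \in H & A e y)
                       (fun y z => exists2 e, e \in H & E e y z) u v.
Proof.
move=> SH; elim: SH A E => {S H} [|x|a b ab|S H a b x SH IH ab abH xS] A E.
- by rewrite eqxx.
- by rewrite eqxx.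
- move=> _ AE _ _; exists a, b.
  apply: internal_ext (AE a b ab (set11 _)) => [y|y z].
    by split=> [Ay|[e]]; [exists [set a; b]; rewrite ?set11 | rewrite inE => /eqP->].
  by split=> [Ey|[e]]; [exists [set a; b]; rewrite ?set11 | rewrite inE => /eqP->].
(* A piece may contain vertices eliminated earlier, so it can be larger than its edge. [A_disj],
   used in both orders, puts a vertex common to two pieces into both of their edges. *)
move=> _ AE A_S A_disj; set e0 := [set a; b] in abH.
set e1 := [set a; x] in AE A_S A_disj *; set e2 := [set b; x] in AE A_S A_disj *.
set H' := _ |: _ in AE A_S A_disj *.
have e1H : e1 \in H' by rewrite !inE eqxx.
have e2H : e2 \in H' by rewrite !inE eqxx orbT.
have HH' e : e \in H -> e \in H' by move=> eH; rewrite !inE eH !orbT.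
have subS e y : e \in H -> y \in e -> y \in S.
  by move=> eH; have [/subsetP eS _] := twotree_edges SH eH; apply: eS.
have aS : a \in S by apply: subS abH _; rewrite !inE eqxx.
have bS : b \in S by apply: subS abH _; rewrite !inE eqxx orbT.
have xH e : e \in H -> x \notin e by move=> eH; apply: contra xS; apply: subS.
have xe1 : x \in e1 by rewrite !inE eqxx orbT.
have xe2 : x \in e2 by rewrite !inE eqxx orbT.
have ax : a != x by apply: contraNneq xS => <-.
have bx : b != x by apply: contraNneq xS => <-.
have e12 : e1 != e2.
  by apply/eqP=> /(set2_inj ax)[] [] /eqP; rewrite ?(negbTE ab) ?(negbTE ax).
have neq1 e : e \in H -> e != e1 by move=> /xH; apply: contraNneq => ->.
have neq2 e : e \in H -> e != e2 by move=> /xH; apply: contraNneq => ->.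
have mem1 y : y \in e1 -> y = x \/ y \in e0.
  by rewrite !inE => /orP[] /eqP->; [right; rewrite eqxx | left].
have mem2 y : y \in e2 -> y = x \/ y \in e0.
  by rewrite !inE => /orP[] /eqP->; [right; rewrite eqxx orbT | left].
(* Eliminating [x]: the piece of [e0] absorbs those of [e1] and [e2], and the other pieces are
   unchanged. *)
pose A' e y := if e == e0 then A e0 y \/ (A e1 y \/ A e2 y) else A e y.
pose E' e y z := if e == e0 then E e0 y z \/ (E e1 y z \/ E e2 y z) else E e y z.
(* The enlarged piece still meets the others properly: a common vertex of the pieces of [e1] (or
   [e2]) and [e] lies in both edges, and it is not [x], which is not in [e]; hence it is an end of
   [e0]. *)
have A'0 e y : e \in H -> e != e0 -> A' e0 y -> A e y -> y \in e /\ y \in e0.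
  move=> eH ee0; rewrite /A' eqxx => -[|[]] Ay Aey.
  - by split; [apply: (A_disj e e0) | apply: (A_disj e0 e)]; rewrite ?HH' // eq_sym.
  - have ye : y \in e by apply: A_disj (neq1 _ eH) Aey Ay; first exact: HH'.
    have /mem1[def_y|//] : y \in e1.
      by apply: A_disj Ay Aey; rewrite // ?HH' // eq_sym neq1.
    by move: (xH _ eH); rewrite -def_y ye.
  - have ye : y \in e by apply: A_disj (neq2 _ eH) Aey Ay; first exact: HH'.
    have /mem2[def_y|//] : y \in e2.
      by apply: A_disj Ay Aey; rewrite // ?HH' // eq_sym neq2.
    by move: (xH _ eH); rewrite -def_y ye.
have E'0 : internal (A' e0) (E' e0) a b.
  rewrite /A' /E' eqxx; apply: internal_parallel; last first.
  - apply: (@internal_series _ _ _ _ a b x); [|exact: AE|].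
      (* The pieces of [e1] and [e2] can only share a vertex of both edges, which is [x]. *)
      move=> y A1 A2; have y1 := A_disj _ _ _ e1H e2H e12 A1 A2.
      have := A_disj _ _ _ e2H e1H _ A2 A1; rewrite eq_sym => /(_ e12).
      move: y1; rewrite !inE => /orP[/eqP->|/eqP-> //].
      by rewrite (negbTE ab) (negbTE ax).
    by apply: internal_swap; apply: AE.
  - by apply: AE => //; apply: HH'.
  - move=> y A0 A12; case: A12 => Ay.
      by apply: A_disj (neq1 _ abH) A0 Ay; first exact: HH'.
    by apply: A_disj (neq2 _ abH) A0 Ay; first exact: HH'.
have [||||u [v Quv]] := IH A' E'.
- by apply/set0Pn; exists e0.
- move=> c d cd cdH; have [cd0|cd0] := eqVneq [set c; d] e0.
    rewrite cd0; have [[-> ->] //|[-> ->]] := set2_inj cd cd0.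
    exact: internal_swap.
  by rewrite /A' /E' (negbTE cd0); apply: AE => //; apply: HH'.
- move=> e y eH yS; have yx : y != x by apply: contraTneq yS => ->.
  rewrite /A'; case: eqP => [->|_]; last by apply: A_S; rewrite ?HH' // !inE yS orbT.
  have yS' : y \in x |: S by rewrite !inE yS orbT.
  case=> [|[]] Ay; first exact: (A_S e0 y (HH' _ abH)).
    by have /mem1[/eqP|//] := A_S e1 y e1H yS' Ay; rewrite (negbTE yx).
  by have /mem2[/eqP|//] := A_S e2 y e2H yS' Ay; rewrite (negbTE yx).
- move=> e e' y eH e'H; have [->|ee0] := eqVneq e e0 => ne A1 A2.
    move: (A'0 e' y e'H); rewrite eq_sym => /(_ ne A1).
    by move: A2; rewrite {1}/A' eq_sym (negbTE ne) => A2 /(_ A2)[].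
  have [e'0|e'0] := eqVneq e' e0.
    move: A1 A2; rewrite e'0 {1}/A' (negbTE ee0) => A1 A2.
    by have [] := A'0 e y eH ee0 A2 A1.
  by move: A1 A2; rewrite /A' (negbTE ee0) (negbTE e'0); apply: A_disj; rewrite ?HH'.
exists u, v; apply: internal_ext Quv => [y|y z].
- split=> [[e eH]|[e]].
    rewrite /A'; case: eqP => [_ [|[]] Ay|_ Ay];
      [exists e0|exists e1|exists e2|exists e] => //; exact: HH'.
  rewrite !inE => /or3P[/eqP->|/eqP->|eH] Ay.
  + by exists e0; rewrite // /A' eqxx; auto.
  + by exists e0; rewrite // /A' eqxx; auto.
  + by exists e; rewrite // /A'; case: eqP => // <-; auto.
- split=> [[e eH]|[e]].
    rewrite /E'; case: eqP => [_ [|[]] Ey|_ Ey];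
      [exists e0|exists e1|exists e2|exists e] => //; exact: HH'.
  rewrite !inE => /or3P[/eqP->|/eqP->|eH] Ey.
  + by exists e0; rewrite // /E' eqxx; auto.
  + by exists e0; rewrite // /E' eqxx; auto.
  + by exists e; rewrite // /E'; case: eqP => // <-; auto.
Qed.

End Internal.

(** * From tree decompositions to 2-trees *)

(** A simple path from [s] to [t] that avoids their edge has at least three nodes, and this edge
    closes it to a forbidden cycle. *)
Lemma tree_edge_cut (T : graph) (s t : T) :
    is_tree T -> adj s t ->
  ~~ connect [rel a b : T | adj a b && ([set a; b] != [set s; t])] s t.
Proof.
move=> [_ irr _ acyc] st; apply/negP=> /connectP[p0 /shortenP[p ep uni _] def_t].
have sub : path adj s p by apply: sub_path ep => a b /andP[].
have cyc : ucycle adj (s :: p).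
  by rewrite /ucycle uni /= rcons_path sub -def_t adj_sym st.
case: p ep uni sub def_t cyc => [|x [|y p]] /=.
- by move=> _ _ _ def_t; rewrite def_t irr in st.
- by move=> /andP[/andP[_ +] _] _ _ def_t; rewrite def_t eqxx.
- by move=> _ _ _ _ /acyc.
Qed.

Lemma connect_leave (T : finType) (e : rel T) (D : {set T}) x y :
    connect e x y -> x \in D -> y \notin D ->
  exists a b, [/\ a \in D, b \notin D & e a b].
Proof.
case/connectP=> p; elim: p x => [|z p IHp] x /= => [_ -> -> //|/andP[xz zp] def_y xD yD].
have [zD|zD] := boolP (z \in D); first exact: (IHp z).
by exists x, z.
Qed.

(** A new node [t] is chosen next to a node [t'] already treated. The vertices of its bag that are
    already present also lie in the bag of [t'], which is a clique, so [twotree_add_bag] applies. *)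
Lemma decomposition_twotree (G T : graph) (beta : T -> {set G}) :
    tree_decomposition beta -> (forall t, #|beta t| <= 3) ->
  exists H, twotree [set: G] H /\ forall t, clique (beta t) H.
Proof.
move=> [treeT cover _ conn] small; have [T_gt0 irr connT _] := treeT.
have /card_gt0P[t0 _] := T_gt0.
have grow n : n < #|T| -> exists (D : {set T}) H,
    [/\ #|D| = n.+1, t0 \in D,
        forall t, t \in D ->
          connect [rel a b : T | [&& a \in D, b \in D & adj a b]] t0 t,
        twotree (\bigcup_(t in D) beta t) H & forall t, t \in D -> clique (beta t) H].
  elim: n => [_|n IHn nT].
    have [||H [tt _ cl]] := @twotree_add_bag _ _ _ (beta t0) (twotree_empty _).
    + exact: small.
    + by move=> y z; rewrite !inE andbF.
    exists [set t0], H; rewrite cards1 set11 big_set1 -[beta t0]setU0; split=> // t.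
      by rewrite inE => /eqP->; apply: connect0.
    by rewrite inE => /eqP->.
  have [D [H [Dn t0D connD tt cl]]] := IHn (ltnW nT).
  have [s sD] : exists s, s \notin D.
    apply/existsP; rewrite -negb_forall; apply: contraTN nT => /forallP allD.
    rewrite -Dn -leqNgt; apply/subset_leq_card/subsetP=> t _; exact: allD.
  have [t' [t [t'D tD]]] :=
    connect_leave (connT t0 s (in_setT _) (in_setT _)) t0D sD.
  rewrite /= !inE => t't.
  (* Otherwise the nodes containing x and the connected set D would link t to
     t' without the tree edge between them. *)
  have parent x : x \in beta t -> x \in \bigcup_(t in D) beta t -> x \in beta t'.
    move=> xt /bigcupP[d dD xd]; apply: contraT => xt'.
    case/negP: (tree_edge_cut treeT t't).
    have D_sub a b : a \in D -> b \in D -> [set a; b] != [set t'; t].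
      move=> aD bD; apply: contraNneq tD => /setP/(_ t).
      by rewrite !inE eqxx orbT => /orP[] /eqP->.
    have in_D a : a \in D ->
        connect [rel a b : T | adj a b && ([set a; b] != [set t'; t])] t0 a.
      move=> /connD; apply: connect_sub => b c /= /and3P[bD cD bc].
      by apply: connect1; rewrite /= bc D_sub.
    apply: (@connect_trans _ _ t0).
      rewrite sym_connect_sym ?in_D // => a b /=.
      by rewrite adj_sym setUC.
    apply: connect_trans (in_D _ dD) _.
    apply: connect_sub (conn x d t _ _); rewrite ?inE // => a b /=.
    rewrite !inE => /and3P[xa xb ab]; apply: connect1; rewrite /= ab /=.
    apply: contraNneq xt' => /setP/(_ t').
    by rewrite !inE eqxx => /orP[] /eqP->.
  have [|H' [tt' HH' cl']] := @twotree_add_bag _ _ _ (beta t) tt (small t).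
  + move=> y z; rewrite !inE => /andP[yt yS] /andP[zt zS].
    by apply: (cl t') => //; apply: parent.
  exists (t |: D), H'; split.
  + by rewrite cardsU1 tD Dn.
  + by rewrite !inE t0D orbT.
  + have sub a : a \in D ->
        connect [rel a b : T | [&& a \in t |: D, b \in t |: D & adj a b]] t0 a.
      move=> /connD; apply: connect_sub => b c /= /and3P[bD cD bc].
      by apply: connect1; rewrite /= !inE bD cD bc !orbT.
    move=> a; rewrite !inE => /orP[/eqP->|/sub //].
    by apply: connect_trans (sub _ t'D) (connect1 _); rewrite /= !inE eqxx t'D t't orbT.
  + by rewrite bigcup_setU big_set1.
  + move=> a; rewrite !inE => /orP[/eqP-> //|aD] y z ya za yz.
    by apply/(subsetP HH')/(cl a).
have [|D [H [Dn _ _ tt cl]]] := grow #|T|.-1; first by rewrite prednK.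
have DT : D = [set: T].
  by apply/eqP; rewrite eqEcard subsetT cardsT Dn prednK //=.
exists H; split=> [|t]; last by apply: cl; rewrite DT inE.
rewrite -cover (_ : \bigcup_t beta t = \bigcup_(t in D) beta t) //.
by apply: eq_bigl => t; rewrite DT inE.
Qed.

(** * From treewidth at most two to [L1plus] *)

Lemma treewidth_underlies (G : graph) :
  0 < #|G| -> treewidth G <= 2 -> underlies_L1plus G.
Proof.
move=> /card_gt0P[x0 _] /treewidth_le[T [beta [dec small]]].
(* A single vertex gives a 2-tree without edges, hence nothing to carry the graph; but it is atomic
   with both labels on it. *)
have [G1|G2] := leqP #|G| 1.
  exists (Bigraph x0 x0); last by exists id => //; exists id.
  by apply: L1plus_atomic => x; left; apply/fintype_le1P.
have [H [tt cl]] := decomposition_twotree dec small.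
have [_ _ edge _] := dec.
have nbr x : exists y, x != y /\ [set x; y] \in H.
  by apply: twotree_neighbor tt _ (in_setT x); rewrite cardsT.
pose A (e : {set G}) y : Prop := y \in e.
(* A loop is put on every edge of the 2-tree at its vertex; the copies coincide because compositions
   remove multiple edges. *)
pose E (e : {set G}) y z : Prop := [/\ y \in e, z \in e & adj y z].
have [|||| u [v [F [f [[LF f_inj] _ _ fA fE]]]]] := @twotree_internal _ _ _ A E tt.
- by have [y [_ yH]] := nbr x0; apply/set0Pn; exists [set x0; y].
- move=> a b _ _; apply: internal_atomic => // y z; first by case; rewrite adj_sym.
  by case.
- by [].
- by [].
have f_surj x : exists a, f a = x.
  by apply/fA; have [y [_ yH]] := nbr x; exists [set x; y] => //; rewrite /A !inE eqxx.
exists F => //; exists f.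
  have gP x : f (sval (cid (f_surj x))) = x by case: cid.
  by exists (fun x => sval (cid (f_surj x))) => // a; apply: f_inj; rewrite gP.
move=> a b; apply/idP/idP=> [ab|ab].
  have /fE[a' [b' [/f_inj-> /f_inj-> //]]] :
      exists2 e, e \in H & E e (f a) (f b).
  (* A loop is found on any edge of the 2-tree at its vertex. Any other edge of [G] lies in a bag,
     which is a clique, so it is itself an edge of the 2-tree. *)
  have [fab|fab] := eqVneq (f a) (f b).
    have [y [_ yH]] := nbr (f a); exists [set f a; y] => //.
    by split; rewrite // -?fab !inE eqxx.
  have [t] := edge _ _ ab; rewrite subUset !sub1set => /andP[at_ bt].
  exists [set f a; f b]; first exact: (cl t).
  by split; rewrite // !inE eqxx ?orbT.
have [e _ [_ _ //]] : exists2 e, e \in H & E e (f a) (f b).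
by apply/fE; exists a, b.
Qed.

Theorem theorem4p20 (G : graph) (G_nonempty : 0 < #|G|) :
  underlies_L1plus G <-> treewidth G <= 2.
Proof.
split; first exact: underlies_treewidth.
exact: treewidth_underlies.
Qed.
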